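(* For any symmetric matrices $M_1,\dots,M_N\in\mathbb{R}^{d\times d}$ and vectors $\bar z_1,\dots,\bar z_N\in\mathbb{R}^d$, there exist differentiable functions $f_1,\dots,f_N:\mathbb{R}^d\to\mathbb{R}$ such that (1) each $f_n$ is $M_n$-matrix-smooth and has a stationary point at $\bar z_n$, and (2) for every standardized $s$ on $\mathbb{R}^d$ with $\mathbb{E}[\mathsf{u}_i^4]=\kappa<\infty$, every distribution $\pi$ on $\{1,\dots,N\}$ with all $\pi(n)>0$, and every $w=(m,C)$, the estimator $\mathsf{g}=\frac{1}{\pi(\mathsf{n})}\nabla_w f_{\mathsf{n}}(T_w(\mathsf{u}))$ (with $\mathsf{u}\sim s$ and $\mathsf{n}\sim\pi$ independent) satisfies \[ \operatorname{tr}\mathbb{V}[\mathsf{g}]\ \ge\ \sum_{n=1}^N\frac{1}{\pi(n)}\Big(d\,\|M_n(m-\bar z_n)\|_2^2+(d+\kappa-1)\|M_nC\|_F^2\Big). \]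
   Context: $\mathbb{V}[\mathsf{g}]$ is the covariance matrix of the random vector $\mathsf{g}$, so $\operatorname{tr}\mathbb{V}[\mathsf{g}]=\mathbb{E}\|\mathsf{g}\|_2^2-\|\mathbb{E}\mathsf{g}\|_2^2$. For a symmetric matrix $M$, $f$ is $M$-matrix-smooth if $\|\nabla f(y)-\nabla f(z)\|_2\le\|M(y-z)\|_2$ for all $y,z$. $T_w(u)=Cu+m$ for $w=(m,C)$, $m\in\mathbb{R}^d$, $C\in\mathbb{R}^{d\times d}$, with $w$ regarded as the vector of all $d+d^2$ entries and $\nabla_w$ the gradient with respect to them. A distribution $s$ on $\mathbb{R}^d$ is standardized if for $\mathsf{u}\sim s$ the components are i.i.d. with $\mathbb{E}\mathsf{u}_1=\mathbb{E}\mathsf{u}_1^3=0$ and $\mathrm{Var}(\mathsf{u}_1)=1$. $\|\cdot\|_F$ is the Frobenius norm. *)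

(* Defs.v *)
From HB Require Import structures.
From mathcomp Require Import all_boot all_order all_algebra.
From mathcomp Require Import all_classical all_reals all_analysis.
Set Implicit Arguments. Unset Strict Implicit. Unset Printing Implicit Defensive.
Import Order.TTheory GRing.Theory Num.Theory.
Import numFieldNormedType.Exports.
Local Open Scope classical_set_scope.
Local Open Scope ring_scope.

Definition fnorm (R : realType) m n (A : 'M[R]_(m, n)) : R :=
  Num.sqrt (\sum_(i < m) \sum_(j < n) A i j ^+ 2).

Definition grad (R : realType) d (f : 'cV[R]_d -> R) (x : 'cV[R]_d) : 'cV[R]_d :=
  \col_(i < d) 'D_(delta_mx i 0) f x.

Definition matrix_smooth (R : realType) d (M : 'M[R]_d) (f : 'cV[R]_d -> R) :=
  forall y z : 'cV[R]_d, fnorm (grad f y - grad f z) <= fnorm (M *m (y - z)).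


Definition gradW_m (R : realType) d (f : 'cV[R]_d -> R) (m : 'cV[R]_d)
  (C : 'M[R]_d) (u : 'cV[R]_d) : 'cV[R]_d :=
  \col_(i < d) 'D_(delta_mx i 0) (fun m' : 'cV[R]_d => f (C *m u + m')) m.

Definition gradW_C (R : realType) d (f : 'cV[R]_d -> R) (m : 'cV[R]_d)
  (C : 'M[R]_d) (u : 'cV[R]_d) : 'M[R]_d :=
  \matrix_(i < d, j < d) 'D_(delta_mx i j) (fun C' : 'M[R]_d => f (C' *m u + m)) C.

(* The random vector u = (X_1, ..., X_d) is standardized with fourth moment
   kappa, and the index Nv is independent of u (joint mutual independence of
   X_1, ..., X_d, Nv, stated as the product rule; Nv is discrete). *)
Definition standardized_indep (R : realType) (dT : measure_display)
  (T : measurableType dT) (P : probability T R) d N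
  (X : 'I_d -> T -> R) (Nv : T -> 'I_N) (kappa : R) : Prop :=
  [/\ (forall i, measurable_fun setT (X i)),
      (forall n, measurable (Nv @^-1` [set n])),
      (forall (B : 'I_d -> set R), (forall i, measurable (B i)) ->
         forall n, fine (P (Nv @^-1` [set n] `&` \bigcap_(i in setT) (X i @^-1` B i)))
           = fine (P (Nv @^-1` [set n])) * \prod_(i < d) fine (P (X i @^-1` B i))),
      (forall i j (B : set R), measurable B -> P (X i @^-1` B) = P (X j @^-1` B)) &
      (forall i, [/\ ('E_P[X i] = 0)%E, ('E_P[fun t => (X i t ^+ 3)%R] = 0)%E,
                   ('V_P[X i] = 1)%E,
                   P.-integrable setT (fun t => (X i t ^+ 4)%:E) &
                   ('E_P[fun t => (X i t ^+ 4)%R] = kappa%:E)%E])].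

Definition trV (R : realType) (dT : measure_display) (T : measurableType dT)
  (P : probability T R) d (gm : T -> 'cV[R]_d) (gC : T -> 'M[R]_d) : \bar R :=
  (\sum_(i < d) 'V_P[fun t => gm t i ord0] +
   \sum_(i < d) \sum_(j < d) 'V_P[fun t => gC t i j])%E.

(* Main.v *)
(** Take [f_n z = (z - zbar_n)^T M_n (z - zbar_n) / 2], whose gradient is
    [M_n (z - zbar_n)], so that matrix smoothness is an equality. With
    [a = M_n (m - zbar_n)] and [B = M_n C], the gradient in [w = (m, C)] has
    entries [y_i] and [y_i u_l], where [y = a + B u]. By independence the
    moments of [u] up to order four give, conditionally on the index [n], the
    means [a_i] and [B_il] and the second moments [a_i^2 + sum_j B_ij^2] and
    [a_i^2 + sum_j B_ij^2 + (kappa - 1) B_il^2]. Cauchy-Schwarz bounds the square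
    of the sum over [n] of the conditional means by the sum of their squares
    weighted by [1 / pi n]; summing over the entries gives the constants
    [d] and [d + kappa - 1]. *)

Require Import Defs.
From HB Require Import structures.
From mathcomp Require Import all_boot all_order all_algebra.
From mathcomp Require Import all_classical all_reals all_analysis.
From mathcomp Require Import finmap measurable_realfun ring lra.
Import Order.TTheory GRing.Theory Num.Theory.
Import numFieldNormedType.Exports.
Local Open Scope classical_set_scope.
Local Open Scope ring_scope.
Set Implicit Arguments. Unset Strict Implicit. Unset Printing Implicit Defensive.

(** * Means of integrable functions and of products with a function of [Y] *)

Section Mean.
Context (R : realType) (dT : measure_display) (T : measurableType dT).
Variable P : probability T R.

(** Integrability and value travel together, since additivity of the integral needs the former at
    every step. *)
Definition has_mean (f : T -> R) (v : R) :=
  P.-integrable setT (EFin \o f) /\ (\int[P]_t (f t)%:E = v%:E)%E.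

Lemma eq_has_mean (f g : T -> R) v w :
  f =1 g -> v = w -> has_mean f v -> has_mean g w.
Proof. by move=> /funext -> ->. Qed.

Lemma has_mean0 : has_mean (fun=> 0) 0.
Proof. by split; [exact: integrable0 | rewrite integral0]. Qed.

Lemma has_meanD f g v w :
  has_mean f v -> has_mean g w -> has_mean (fun t => f t + g t) (v + w).
Proof.
move=> [fi fE] [gi gE]; split; first exact: (integrableD measurableT fi gi).
by rewrite EFinD -fE -gE -integralD_EFin.
Qed.

Lemma has_meanZ k f v : has_mean f v -> has_mean (fun t => k * f t) (k * v).
Proof.
move=> [fi fE]; split; first exact: (integrableZl measurableT k fi).
by rewrite EFinM -fE -integralZl.
Qed.

Lemma has_mean_sum (I : Type) (s : seq I) (f : I -> T -> R) (v : I -> R) :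
  (forall i, has_mean (f i) (v i)) ->
  has_mean (fun t => \sum_(i <- s) f i t) (\sum_(i <- s) v i).
Proof.
move=> H; elim: s => [|i s IH].
  by apply: eq_has_mean has_mean0 => [t|]; rewrite big_nil.
by apply: eq_has_mean (has_meanD (H i) IH) => [t|]; rewrite big_cons.
Qed.

Section MulComp.
Import HBSimple HBNNSimple.
Variables (Z Y : T -> R) (c : R).
Hypothesis mY : measurable_fun setT Y.
(** This is E[Z | Y] = c, tested on the events generated by [Y]. The section extends it from
    indicators to general functions of [Y]. *)
Hypothesis ZY : forall B : set R, measurable B ->
  has_mean (fun t => Z t * \1_B (Y t)) (c * fine (P (Y @^-1` B))).

Let mZ : measurable_fun setT Z.
Proof.
have [/measurable_int/measurable_EFinP + _] := ZY measurableT.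
by congr (measurable_fun _ _); apply/funext => t; rewrite indicT mulr1.
Qed.

Let mean_indic_comp (B : set R) : measurable B ->
  has_mean (fun t => \1_B (Y t)) (fine (P (Y @^-1` B))).
Proof.
move=> mB.
have mYB : measurable (Y @^-1` B) by rewrite -[X in measurable X]setTI; exact: mY.
have -> : (fun t => \1_B (Y t) : R) = \1_(Y @^-1` B).
  by apply/funext => t; rewrite !indicE.
split; last by rewrite integral_indic// setIT fineK// fin_num_measure.
by apply: integrable_indic => //; rewrite setIT ltey_eq fin_num_measure.
Qed.

(** A simple function is a finite combination of indicators of its level sets, so linearity
    suffices. Sharing [v] between the two means lets both pass to the same limit. *)
Let mean_mul_nnsfun_comp (s : {nnsfun R >-> R}) :
  exists2 v, has_mean (fun t => s (Y t)) v & has_mean (fun t => Z t * s (Y t)) (c * v).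
Proof.
set S := fset_set (range s).
exists (\sum_(i < #|`S|) S`_i * fine (P (Y @^-1` (s @^-1` [set S`_i])))).
  apply: (@eq_has_mean (fun t => \sum_(i < #|`S|)
    S`_i * \1_(s @^-1` [set S`_i]) (Y t))) (erefl _) _.
    by move=> t; rewrite [RHS]fimfunEord.
  by apply: has_mean_sum => i; apply/has_meanZ/mean_indic_comp.
apply: (@eq_has_mean (fun t => \sum_(i < #|`S|)
  S`_i * (Z t * \1_(s @^-1` [set S`_i]) (Y t)))).
- move=> t; rewrite [in RHS]fimfunEord mulr_sumr.
  by apply: eq_bigr => i _; rewrite mulrCA.
- by rewrite mulr_sumr; apply: eq_bigr => i _; rewrite mulrCA; reflexivity.
- by apply: has_mean_sum => i; apply/has_meanZ/ZY.
Qed.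

(** Simple functions increase to [phi]. As [Z] may change sign, monotone convergence is replaced by
    dominated convergence, with bounds [phi (Y t)] and [|Z t * phi (Y t)|]; uniqueness of the limit
    then identifies the mean. *)
Let mean_mul_comp_ge0 (phi : R -> R) (v : R) : measurable_fun setT phi ->
  (forall x, 0 <= phi x) ->
  P.-integrable setT (EFin \o (fun t => Z t * phi (Y t))) ->
  has_mean (phi \o Y) v -> has_mean (fun t => Z t * phi (Y t)) (c * v).
Proof.
move=> mphi phi0 iZ [iphi phiE].
have mphiE : measurable_fun setT (EFin \o phi) by apply/measurable_EFinP.
pose s n : {nnsfun R >-> R} := nnsfun_approx measurableT mphiE n.
have s_cvg x : (fun n => (s n x)%:E) @ \oo --> (phi x)%:E.
  by apply: (cvg_nnsfun_approx measurableT mphiE) => // y _; rewrite lee_fin.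
have s_le n x : s n x <= phi x.
  rewrite -lee_fin /s nnsfun_approxE.
  by apply: (le_approx (f := EFin \o phi)) => // y _; rewrite /= lee_fin.
have ms n : measurable_fun setT (fun t => s n (Y t)).
  by apply: measurableT_comp.
have [v_ sE ZsE] : exists2 v_ : nat -> R, forall n, has_mean (fun t => s n (Y t)) (v_ n) &
    forall n, has_mean (fun t => Z t * s n (Y t)) (c * v_ n).
  have H n := cid2 (mean_mul_nnsfun_comp (s n)).
  by exists (fun n => sval (H n)) => n; case: (H n).
have [|||//||_ _ cvg1] := @dominated_convergence _ _ _ P setT measurableT
  (fun n t => (s n (Y t))%:E) (fun t => (phi (Y t))%:E) (fun t => (phi (Y t))%:E).
- by move=> n; apply/measurable_EFinP.
- exact: measurable_int iphi.
- by apply: aeW => t _; exact: s_cvg.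
- by apply: aeW => t n _; rewrite abse_EFin ger0_norm// lee_fin.
have [|||||_ _ cvg2] := @dominated_convergence _ _ _ P setT measurableT
  (fun n t => (Z t * s n (Y t))%:E) (fun t => (Z t * phi (Y t))%:E)
  (fun t => `|(Z t * phi (Y t))%:E|%E).
- by move=> n; apply/measurable_EFinP/measurable_funM.
- exact: measurable_int iZ.
- apply: aeW => t _; rewrite EFinM; under eq_fun do rewrite EFinM.
  exact: cvgeZl.
- exact: integrable_abse.
- apply: aeW => t n _; rewrite !abse_EFin lee_fin !normrM.
  by rewrite ler_wpM2l// !ger0_norm.
split=> //.
have {}cvg1 : (fun n => (c * v_ n)%:E) @ \oo --> (c * v)%:E.
  rewrite EFinM; under eq_fun do rewrite EFinM.
  apply: cvgeZl => //; rewrite -phiE.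
  rewrite (_ : (fun n => (v_ n)%:E) = fun n => (\int[P]_t (s n (Y t))%:E)%E) //.
  by apply/funext => n; case: (sE n).
have {}cvg2 : (fun n => (c * v_ n)%:E) @ \oo --> (\int[P]_t (Z t * phi (Y t))%:E)%E.
  rewrite (_ : (fun n => _) = fun n => (\int[P]_t (Z t * s n (Y t))%:E)%E) //.
  by apply/funext => n; case: (ZsE n).
exact: cvg_unique cvg2 cvg1.
Qed.

(** Writes [phi] as the difference of the nonnegative functions [phi + |phi|] and [|phi|], to which
    the previous case applies. *)
Lemma mean_mul_comp (phi : R -> R) (v : R) : measurable_fun setT phi ->
  P.-integrable setT (EFin \o (fun t => Z t * phi (Y t))) ->
  has_mean (phi \o Y) v -> has_mean (fun t => Z t * phi (Y t)) (c * v).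
Proof.
move=> mphi iZ phiE.
have iabs : P.-integrable setT (EFin \o (fun t => `|phi (Y t)|)).
  by case: phiE => /integrable_norm.
have iZabs : P.-integrable setT (EFin \o (fun t => Z t * `|phi (Y t)|)).
  apply: le_integrable iZ => //=.
    apply/measurable_EFinP/measurable_funM => //.
    by apply: measurableT_comp => //; apply: measurableT_comp.
  by move=> t _; rewrite lee_fin !normrM normr_id.
pose v' := fine (\int[P]_t (`|phi (Y t)|)%:E)%E.
have absE : has_mean (fun t => `|phi (Y t)|) v'.
  by split=> //; rewrite fineK// integrable_fin_num.
have mabs : measurable_fun setT (fun x => `|phi x|) by apply: measurableT_comp.
have H1 := mean_mul_comp_ge0 mabs (fun x => normr_ge0 _) iZabs absE.
have H2 : has_mean (fun t => Z t * (phi (Y t) + `|phi (Y t)|)) (c * (v + v')).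
  apply: (mean_mul_comp_ge0 (phi := fun x => phi x + `|phi x|)) (has_meanD phiE absE).
  - exact: measurable_funD.
  - by move=> x; have := ler_norm (- phi x); rewrite normrN; lra.
  - have := integrableD measurableT iZ iZabs.
    by congr (P.-integrable _ _); apply/funext => t /=; rewrite mulrDr.
apply: eq_has_mean (has_meanD H2 (has_meanZ (-1) H1)) => [t|]; ring.
Qed.

End MulComp.
End Mean.

(** * Factorization of moments of the independent coordinates and the index *)

Lemma ler_prod_exp_sum4 (R : realType) (d : nat) (x : 'I_d -> R) (e : 'I_d -> nat) :
  (\sum_i e i <= 4)%N ->
  \prod_i `|x i| ^+ e i <= 1 + \sum_i x i ^+ 4.
Proof.
move=> e4; set S := 1 + _.
have x4 i : 0 <= x i ^+ 4 by rewrite exprn_even_ge0.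
have S1 : 1 <= S by rewrite lerDl sumr_ge0.
(* The fourth root of [S] dominates 1 and every [|x i|], so the product is at most [m] to a power at
   most four. *)
pose m := Num.sqrt (Num.sqrt S).
have mE : m ^+ 4 = S.
  by rewrite (exprM m 2 2) !sqr_sqrtr ?sqrtr_ge0// (le_trans ler01).
have m1 : 1 <= m by rewrite -(@ler_pXn2r _ 4) ?nnegrE ?sqrtr_ge0// mE expr1n.
have xm i : `|x i| <= m.
  rewrite -(@ler_pXn2r _ 4) ?nnegrE ?sqrtr_ge0//.
  rewrite mE -normrX ger0_norm// /S (bigD1 i)//=.
  have : 0 <= \sum_(j | j != i) x j ^+ 4 by rewrite sumr_ge0.
  by lra.
apply: (@le_trans _ _ (\prod_i m ^+ e i)).
  by apply: ler_prod => i _; rewrite exprn_ge0//= lerXn2r// nnegrE sqrtr_ge0.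
by rewrite -expr_sum -mE ler_weXn2l.
Qed.

Section Moments.
Context (R : realType) (dT : measure_display) (T : measurableType dT).
Variable P : probability T R.
Variables (d N : nat) (X : 'I_d -> T -> R) (Nv : T -> 'I_N).
Hypothesis mX : forall i, measurable_fun setT (X i).
Hypothesis mNv : forall n, measurable (Nv @^-1` [set n]).
Hypothesis indep : forall (B : 'I_d -> set R), (forall i, measurable (B i)) ->
   forall n, fine (P (Nv @^-1` [set n] `&` \bigcap_(i in setT) (X i @^-1` B i)))
     = fine (P (Nv @^-1` [set n])) * \prod_(i < d) fine (P (X i @^-1` B i)).
Hypothesis iX4 : forall i, P.-integrable setT (fun t => (X i t ^+ 4)%:E).

Let has_mean := @has_mean R dT T P.

(** Exponent 0 gives the indicator of [B] and [B = setT] gives the plain power, so one family links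
    the product rule for events to monomials. *)
Let h (e : nat) (B : set R) (x : R) : R := x ^+ e * \1_B x.

Let mh e B : measurable B -> measurable_fun setT (h e B).
Proof.
move=> mB; apply: measurable_funM; first exact: exprn_measurable.
exact: measurable_indic.
Qed.

Let h_le e B x : `|h e B x| <= `|x| ^+ e.
Proof.
rewrite /h normrM normrX ler_piMr ?exprn_ge0// indicE.
by case: (x \in B); rewrite ?normr1 ?normr0.
Qed.

(** By [ler_prod_exp_sum4] this single function dominates every product of total degree at most
    four. *)
Let isum4 : P.-integrable setT (fun t => (1 + \sum_i X i t ^+ 4)%:E).
Proof.
under eq_fun do rewrite EFinD -sumEFin.
apply: integrableD => //; last exact: integrable_sum.
by apply: finite_measure_integrable_cst.
Qed.

(** Conditioning on the index is expressed by this factor, so the means carry the probability of the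
    event as a factor. *)
Definition ind (n : 'I_N) (t : T) : R := (Nv t == n)%:R.

Lemma indE n : ind n = \1_(Nv @^-1` [set n]).
Proof.
apply/funext => t; rewrite /ind indicE.
by have -> : (t \in Nv @^-1` [set n]) = (Nv t == n) by apply/idP/eqP; rewrite in_setE.
Qed.

Lemma measurable_ind n : measurable_fun setT (ind n).
Proof. by rewrite indE; exact: measurable_indic. Qed.

Let integrable_prod (n : 'I_N) e B : (\sum_i e i <= 4)%N ->
  (forall i, measurable (B i)) ->
  P.-integrable setT (EFin \o (fun t => ind n t * \prod_i h (e i) (B i) (X i t))).
Proof.
move=> e4 mB; apply: le_integrable isum4 => //.
  apply/measurable_EFinP/measurable_funM; first exact: measurable_ind.
  by apply: measurable_prod => i _; apply: measurableT_comp => //; exact: mh.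
move=> t _; rewrite /= lee_fin normrM normr_prod.
apply: (@le_trans _ _ (1 + \sum_i X i t ^+ 4)); last exact: ler_norm.
apply: le_trans (ler_prod_exp_sum4 (fun i => X i t) e4).
apply: (@le_trans _ _ (\prod_i `|h (e i) (B i) (X i t)|)).
  rewrite ler_piMl ?prodr_ge0// /ind.
  by case: (Nv t == n); rewrite ?normr1 ?normr0.
by apply: ler_prod => i _; rewrite normr_ge0 h_le.
Qed.

Let integrable_h e B i : (e <= 4)%N -> measurable B ->
  P.-integrable setT (EFin \o (h e B \o X i)).
Proof.
move=> e4 mB; apply: le_integrable isum4 => //.
  by apply/measurable_EFinP; apply: measurableT_comp => //; exact: mh.
move=> t _; rewrite /= lee_fin.
apply: (@le_trans _ _ (1 + \sum_i X i t ^+ 4)); last exact: ler_norm.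
apply: le_trans (h_le _ _ _) _.
have := @ler_prod_exp_sum4 _ _ (fun i => X i t) (fun j => if j == i then e else 0%N).
rewrite (bigD1 i)//= eqxx big1 ?addn0; last by move=> j /negPf ->.
rewrite (bigD1 i)//= eqxx big1 ?mulr1; first exact.
by move=> j /negPf ->; rewrite expr0.
Qed.

Definition mean (f : T -> R) : R := fine (\int[P]_t (f t)%:E)%E.

Lemma has_mean_mean f : P.-integrable setT (EFin \o f) -> has_mean f (mean f).
Proof. by move=> fi; split=> //; rewrite fineK// integrable_fin_num. Qed.

Let mean_h0 B i : measurable B -> mean (h 0 B \o X i) = fine (P (X i @^-1` B)).
Proof.
move=> mB; rewrite /mean.
have -> : (fun t => ((h 0 B \o X i) t)%:E) = EFin \o \1_(X i @^-1` B).
  by apply/funext => t /=; rewrite /h expr0 mul1r !indicE.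
by rewrite integral_indic ?setIT// -[X in measurable X]setTI; exact: mX.
Qed.

(* One exponent at a time is switched on, the remaining factors being indicators. *)
Let has_mean_prod_h n k e B : (k <= d)%N -> (\sum_i e i <= 4)%N ->
  (forall i : 'I_d, (k <= i)%N -> e i = 0%N) -> (forall i, measurable (B i)) ->
  has_mean (fun t => ind n t * \prod_i h (e i) (B i) (X i t))
    (fine (P (Nv @^-1` [set n])) * \prod_i mean (h (e i) (B i) \o X i)).
Proof.
elim: k e B => [|k IH] e B kd e4 e0 mB.
  (* With all exponents zero the product is the indicator of an intersection of events, and [indep]
     applies directly. *)
  have -> : (fun t => ind n t * \prod_i h (e i) (B i) (X i t)) =
      \1_(Nv @^-1` [set n] `&` \bigcap_(i in setT) (X i @^-1` B i)).
    apply/funext => t; rewrite indE !indicE in_setI -mulnb natrM; congr (_ * _).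
    rewrite (eq_bigr (fun i => \1_(B i) (X i t))); last first.
      by move=> i _; rewrite /h e0// expr0 mul1r.
    have [BX|/existsNP[i BXi]] := pselect (forall i, B i (X i t)).
      rewrite mem_set; last by move=> i _; exact: BX.
      by apply: big1 => i _; rewrite indicE mem_set.
    rewrite memNset; last by move=> /(_ i I).
    by rewrite (bigD1 i)//= indicE memNset// mul0r.
  have mXB i : measurable (X i @^-1` B i).
    by rewrite -[X in measurable X]setTI; exact: mX.
  have mI : measurable (Nv @^-1` [set n] `&` \bigcap_(i in setT) (X i @^-1` B i)).
    by apply: measurableI => //; apply: fin_bigcap_measurable.
  split.
    by apply: integrable_indic => //; rewrite setIT ltey_eq fin_num_measure.
  rewrite integral_indic// setIT -[LHS]fineK ?fin_num_measure//.
  rewrite indep//; congr (_ * _)%:E.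
  by apply: eq_bigr => i _; rewrite e0// mean_h0.
pose i0 := Ordinal kd.
(* Resetting the exponent at [i0] to zero and freeing its set to an arbitrary [D] turns the
   induction hypothesis into the assumption [ZY], with [Z] the product of all other factors. *)
pose e' i := if i == i0 then 0%N else e i.
pose B' D i := if i == i0 then D else B i.
have mB' D i : measurable D -> measurable (B' D i) by rewrite /B'; case: eqP.
pose Z t := ind n t * \prod_(i | i != i0) h (e i) (B i) (X i t).
pose c := fine (P (Nv @^-1` [set n])) * \prod_(i | i != i0) mean (h (e i) (B i) \o X i).
have ZY (D : set R) : measurable D ->
    has_mean (fun t => Z t * \1_D (X i0 t)) (c * fine (P (X i0 @^-1` D))).
  move=> mD.
  apply: eq_has_mean (IH e' (B' D) (ltnW kd) _ _ (fun i => mB' D i mD)) => [t|||].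
  - rewrite (bigD1 i0)//= /e' /B' eqxx /h expr0 mul1r /Z mulrCA mulrC.
    by congr (_ * _ * _); apply: eq_bigr => i /negPf ->.
  - rewrite (bigD1 i0)//= /e' /B' eqxx mean_h0// mulrCA mulrC /c.
    by congr (_ * _ * _); apply: eq_bigr => i /negPf ->.
  - apply: leq_trans e4; apply: leq_sum => i _.
    by rewrite /e'; case: eqP.
  - move=> i ki; rewrite /e'; case: eqP => // /eqP ii0; apply: e0.
    by rewrite ltn_neqAle ki andbT eq_sym.
have ei4 : (e i0 <= 4)%N by rewrite (leq_trans _ e4)// (bigD1 i0)//= leq_addr.
have := mean_mul_comp (mX i0) ZY (mh (e i0) (mB i0)) _
  (has_mean_mean (integrable_h i0 ei4 (mB i0))).
have -> : (fun t : T => Z t * h (e i0) (B i0) (X i0 t)) =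
   (fun t : T => ind n t * \prod_i h (e i) (B i) (X i t)).
  by apply/funext => t; rewrite [in RHS](bigD1 i0)//= [RHS]mulrCA [RHS]mulrC.
rewrite [in X in _ -> X](bigD1 i0)//= [in X in _ -> X]mulrCA
  [in X in _ -> X](mulrC (mean _)); apply.
exact: integrable_prod.
Qed.

Lemma integrable_exp e i : (e <= 4)%N -> P.-integrable setT (EFin \o (fun t => X i t ^+ e)).
Proof.
move=> e4; have := integrable_h i e4 measurableT.
by congr (P.-integrable _ _); apply/funext => t; rewrite /= /h indicT mulr1.
Qed.

(** Listing the factors with repetition makes the exponent of each coordinate its number of
    occurrences, so coincidences among indices need no separate lemmas. *)
Lemma has_mean_monomial (n : 'I_N) (s : seq 'I_d) (mu : nat -> R) :
  (size s <= 4)%N ->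
  (forall i e, (e <= 4)%N -> has_mean (fun t => X i t ^+ e) (mu e)) ->
  has_mean (fun t => ind n t * \prod_(i <- s) X i t)
    (fine (P (Nv @^-1` [set n])) * \prod_i mu (count_mem i s)).
Proof.
move=> s4 muE.
have e4 : (\sum_i count_mem i s <= 4)%N.
  apply: leq_trans s4; elim: s => [|j s IH] /=; first by rewrite big1.
  rewrite big_split/= (bigD1 j)//= eqxx big1 ?addn0 ?add1n//.
  by move=> i /negPf; rewrite eq_sym => ->.
have c4 i : (count_mem i s <= 4)%N by rewrite (leq_trans (count_size _ _)).
apply: eq_has_mean (has_mean_prod_h n (leqnn d) e4 _ (fun=> measurableT)) => [t||].
- congr (_ * _).
  under eq_bigr do rewrite /h indicT mulr1.
  elim: s {s4 e4 c4} => [|j s IH] /=; first by rewrite big_nil big1.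
  rewrite big_cons -IH; under eq_bigr do rewrite exprD.
  rewrite big_split/= (bigD1 j)//= eqxx expr1 big1 ?mulr1//.
  by move=> i /negPf; rewrite eq_sym => ->.
- congr (_ * _); apply: eq_bigr => i _; rewrite /mean.
  have [_] := muE i _ (c4 i).
  rewrite (_ : (fun t => (X i t ^+ _)%:E) =
     (fun t => ((h (count_mem i s) setT \o X i) t)%:E)); first by move=> ->.
  by apply/funext => t; rewrite /= /h indicT mulr1.
- by move=> i; rewrite leqNgt ltn_ord.
Qed.

(** * Mixed moments of standardized coordinates up to order four *)

Section Standardized.
Variable kappa : R.
Hypothesis EX : forall i, ('E_P[X i] = 0)%E.
Hypothesis EX3 : forall i, ('E_P[fun t => (X i t ^+ 3)%R] = 0)%E.
Hypothesis VX : forall i, ('V_P[X i] = 1)%E.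
Hypothesis EX4 : forall i, ('E_P[fun t => (X i t ^+ 4)%R] = kappa%:E)%E.

(** The list holds the moments of orders 0 to 4; the default value beyond them stands for no
    moment. *)
Definition std_moment (e : nat) : R := nth 0 [:: 1; 0; 1; 0; kappa] e.

Lemma has_mean_exp i e : (e <= 4)%N -> has_mean (fun t => X i t ^+ e) (std_moment e).
Proof.
move=> e4; split; first exact: integrable_exp.
have E1 := EX i; have E3 := EX3 i; have E4 := EX4 i; have V := VX i.
rewrite unlock in E1; rewrite unlock in E3; rewrite unlock in E4.
case: e e4 => [|[|[|[|[|//]]]]] _ //=.
- by under eq_integral do rewrite expr0; rewrite integral_cst// mul1e; exact: probability_setT.
(* Since the mean is zero, the integrand of the variance is the square itself. *)
- rewrite /variance unlock EX unlock /= in V.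
  rewrite -[RHS]V; apply: eq_integral => t _.
  by rewrite !fctE /= subr0 -expr2.
Qed.

Local Notation p n := (fine (P (Nv @^-1` [set n]))).

Let mono n (s : seq 'I_d) (s4 : (size s <= 4)%N) := has_mean_monomial n s4 has_mean_exp.

Lemma has_mean_ind n : has_mean (ind n) (p n).
Proof.
apply: eq_has_mean (@mono n [::] isT) => [t|]; first by rewrite big_nil mulr1.
by rewrite big1 ?mulr1.
Qed.

Lemma has_mean_ind_coord n i : has_mean (fun t => ind n t * X i t) 0.
Proof.
apply: eq_has_mean (@mono n [:: i] isT) => [t|].
  by rewrite big_cons big_nil mulr1.
by rewrite (bigD1 i)//= eqxx mul0r mulr0.
Qed.

Lemma has_mean_ind_coord2 n i j :
  has_mean (fun t => ind n t * (X i t * X j t)) (p n * (i == j)%:R).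
Proof.
apply: eq_has_mean (@mono n [:: i; j] isT) => [t|].
  by rewrite !big_cons big_nil mulr1.
congr (_ * _); rewrite (bigD1 i)//= eqxx eq_sym.
have [<-|ij] := eqVneq i j; last by rewrite mul0r.
by rewrite mul1r big1// => k /negPf; rewrite eq_sym => ->.
Qed.

(** Coordinate [i] occurs to the third power if [i = l] and to the first otherwise; both moments
    vanish. *)
Lemma has_mean_ind_coord3 n i l :
  has_mean (fun t => ind n t * (X i t * X l t ^+ 2)) 0.
Proof.
apply: eq_has_mean (@mono n [:: i; l; l] isT) => [t|].
  by rewrite !big_cons big_nil mulr1.
rewrite (bigD1 i)//= eqxx.
by have [->|li] := eqVneq l i; rewrite mul0r mulr0.
Qed.

(** If [i] and [j] differ, [i] occurs to the first or third power and the mean vanishes. If they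
    agree, the moment is [kappa] when [l] coincides with them and 1 otherwise. *)
Lemma has_mean_ind_coord4 n i j l :
  has_mean (fun t => ind n t * (X i t * X j t * X l t ^+ 2))
    (p n * ((i == j)%:R * (1 + (kappa - 1) * (i == l)%:R))).
Proof.
apply: eq_has_mean (@mono n [:: i; j; l; l] isT) => [t|].
  by rewrite !big_cons big_nil; ring.
congr (_ * _); rewrite (bigD1 i)//= eqxx (eq_sym j) (eq_sym l).
have [<-|ij] := eqVneq i j; last first.
  by have [il|il] := eqVneq i l; rewrite !mul0r.
have [<-|il] := eqVneq i l.
  rewrite big1 ?mulr1 ?mul1r; first by rewrite /std_moment /=; lra.
  by move=> k /negPf; rewrite eq_sym => ->.
rewrite (bigD1 l)//=; last by rewrite eq_sym.
rewrite eqxx (negPf il) big1; first by rewrite /std_moment /=; lra.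
by move=> k /andP[/negPf + /negPf]; rewrite (eq_sym k) (eq_sym k) => -> ->.
Qed.

(** * Moments of an affine form in the coordinates *)

Section Affine.
Variables (a : R) (b : 'I_d -> R).
(** One coordinate of the gradient: [a] will be an entry of [M n *m (m - zbar n)] and [b] a row of
    [M n *m C]. *)
Let y t := a + \sum_j b j * X j t.

Let yM (f : T -> R) t : y t * f t = a * f t + \sum_j b j * (X j t * f t).
Proof.
by rewrite mulrDl mulr_suml; congr (_ + _); apply: eq_bigr => j _; rewrite mulrA.
Qed.

(** Expands one factor [y] at a time; the squares arise by applying it twice. *)
Let has_mean_yM n f v w : has_mean (fun t => ind n t * f t) v ->
  (forall j, has_mean (fun t => ind n t * (X j t * f t)) (w j)) ->
  has_mean (fun t => ind n t * (y t * f t)) (a * v + \sum_j b j * w j).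
Proof.
move=> fv fw.
apply: eq_has_mean (has_meanD (has_meanZ a fv)
  (has_mean_sum (index_enum 'I_d) (fun j => has_meanZ (b j) (fw j)))) => // t.
rewrite yM mulrDr mulr_sumr; congr (_ + _); first by rewrite mulrCA.
by apply: eq_bigr => j _; rewrite mulrCA.
Qed.

Let sum_delta (F : 'I_d -> R) i : \sum_j F j * (j == i)%:R = F i.
Proof.
rewrite (bigD1 i)//= eqxx mulr1 big1 ?addr0// => j /negPf ->.
by rewrite mulr0.
Qed.

Lemma has_mean_affine n : has_mean (fun t => ind n t * y t) (p n * a).
Proof.
apply: eq_has_mean (@has_mean_yM n (fun=> 1) (p n) (fun=> 0) _ _) => [t|||j].
- by rewrite mulr1.
- by rewrite big1 ?addr0 1?mulrC// => j _; rewrite mulr0.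
- by apply: eq_has_mean (has_mean_ind n) => // t; rewrite mulr1.
- by apply: eq_has_mean (has_mean_ind_coord n j) => // t; rewrite mulr1.
Qed.

Lemma has_mean_affine_coord n l :
  has_mean (fun t => ind n t * (y t * X l t)) (p n * b l).
Proof.
apply: eq_has_mean (has_mean_yM (has_mean_ind_coord n l)
  (fun j => has_mean_ind_coord2 n j l)) => [//|].
under eq_bigr do rewrite mulrCA.
by rewrite -mulr_sumr sum_delta mulr0 add0r.
Qed.

Lemma has_mean_affine_sqr n :
  has_mean (fun t => ind n t * y t ^+ 2) (p n * (a ^+ 2 + \sum_j b j ^+ 2)).
Proof.
apply: eq_has_mean (has_mean_yM (has_mean_affine n) (w := fun j => p n * b j) _) => [//||j].
  rewrite mulrDr mulr_sumr mulrCA; congr (_ + _).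
  by apply: eq_bigr => j _; rewrite mulrCA.
by apply: eq_has_mean (has_mean_affine_coord n j) => // t; rewrite [X in _ * X]mulrC.
Qed.

(** The terms linear in [b] vanish by [has_mean_ind_coord3]. Among the quadratic ones only the
    diagonal survives, where index [l] has mean [kappa] instead of 1; hence the excess
    [kappa - 1]. *)
Lemma has_mean_affine_coord_sqr n l :
  has_mean (fun t => ind n t * (y t * X l t) ^+ 2)
    (p n * (a ^+ 2 + \sum_j b j ^+ 2 + (kappa - 1) * b l ^+ 2)).
Proof.
have H1 : has_mean (fun t => ind n t * (y t * X l t ^+ 2)) (p n * a).
  apply: eq_has_mean (has_mean_yM (v := p n) _ (fun j => has_mean_ind_coord3 n j l)) => [//||].
    by rewrite big1 ?addr0 1?mulrC// => j _; rewrite mulr0.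
  apply: eq_has_mean (has_mean_ind_coord2 n l l) => //.
  by rewrite eqxx mulr1.
have H2 i : has_mean (fun t => ind n t * (X i t * (y t * X l t ^+ 2)))
    (p n * (b i * (1 + (kappa - 1) * (i == l)%:R))).
  apply: eq_has_mean (@has_mean_yM n (fun t => X i t * X l t ^+ 2) _
    (fun j => p n * ((j == i)%:R * (1 + (kappa - 1) * (j == l)%:R)))
    (has_mean_ind_coord3 n i l) _) => [t||].
  - by congr (_ * _); rewrite mulrCA.
  - rewrite mulr0 add0r -[RHS](sum_delta
      (fun j => p n * (b j * (1 + (kappa - 1) * (j == l)%:R)))).
    by apply: eq_bigr => j _; ring.
  - by move=> j; apply: eq_has_mean (has_mean_ind_coord4 n j i l) => // t; congr (_ * _); rewrite mulrA.
apply: eq_has_mean (has_mean_yM H1 H2) => [t|]; first by congr (_ * _); ring.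
rewrite -[b l ^+ 2](sum_delta (fun j => b j ^+ 2)) !mulrDr !mulr_sumr -addrA -big_split/=.
by congr (_ + _); [ring | apply: eq_bigr => j _; ring].
Qed.

End Affine.
End Standardized.

End Moments.

(** * Variance of a reweighted mixture over the random index *)

Lemma sum_ind_select (R : realType) (dT : measure_display) (T : measurableType dT)
    (N : nat) (Nv : T -> 'I_N) (F : 'I_N -> R) t :
  \sum_n ind R Nv n t * F n = F (Nv t).
Proof.
rewrite (bigD1 (Nv t))//= /ind eqxx mul1r big1 ?addr0// => n.
by rewrite eq_sym => /negPf ->; rewrite mul0r.
Qed.

(** The variance of [q n / p n] under the weights [p] is nonnegative; expanding it gives the
    claim. *)
Lemma sqr_sum_le_weighted (R : realType) (N : nat) (p q : 'I_N -> R) :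
  (forall n, 0 < p n) -> \sum_n p n = 1 ->
  (\sum_n q n) ^+ 2 <= \sum_n (p n)^-1 * q n ^+ 2.
Proof.
move=> p0 p1; set S := \sum_n q n.
have : 0 <= \sum_n p n * ((p n)^-1 * q n - S) ^+ 2.
  by apply: sumr_ge0 => n _; rewrite mulr_ge0 ?sqr_ge0// ltW.
rewrite (eq_bigr (fun n => (p n)^-1 * q n ^+ 2 + ((- 2 * S) * q n + S ^+ 2 * p n))); last first.
  by move=> n _; field; rewrite gt_eqF.
rewrite !big_split/= -!mulr_sumr p1 -/S; lra.
Qed.

(** When [p] is the law of the index, [q n] and [s n] are the conditional mean and second moment.
    The variance is computed exactly; bounding the squared mean by [sqr_sum_le_weighted] is the only
    loss in the whole bound. *)
Lemma variance_mixture_ge (R : realType) (dT : measure_display) (T : measurableType dT)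
    (P : probability T R) (N : nat) (Nv : T -> 'I_N) (p q s : 'I_N -> R)
    (y : 'I_N -> T -> R) :
  (forall n, 0 < p n) -> \sum_n p n = 1 ->
  (forall n, has_mean P (fun t => ind R Nv n t * y n t) (p n * q n)) ->
  (forall n, has_mean P (fun t => ind R Nv n t * y n t ^+ 2) (p n * s n)) ->
  ((\sum_n (p n)^-1 * (s n - q n ^+ 2))%:E <=
    'V_P[fun t => ((p (Nv t))^-1 * y (Nv t) t)%R])%E.
Proof.
move=> p0 p1 yq ys; set Y := fun t : T => _.
have EY : has_mean P Y (\sum_n q n).
  apply: eq_has_mean (has_mean_sum (index_enum _)
    (fun n => has_meanZ (p n)^-1 (yq n))) => [t|].
    rewrite /Y -(sum_ind_select Nv (fun n => (p n)^-1 * y n t)).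
    by apply: eq_bigr => n _; rewrite mulrCA.
  by apply: eq_bigr => n _; rewrite mulKf ?gt_eqF.
have EY2 : has_mean P (Y * Y) (\sum_n (p n)^-1 * s n).
  apply: eq_has_mean (has_mean_sum (index_enum _)
    (fun n => has_meanZ ((p n)^-1 ^+ 2) (ys n))) => [t|].
    rewrite [RHS](_ : _ = ((p (Nv t))^-1 * y (Nv t) t) ^+ 2)//.
    rewrite -(sum_ind_select Nv (fun n => ((p n)^-1 * y n t) ^+ 2)).
    by apply: eq_bigr => n _; rewrite mulrCA exprMn.
  by apply: eq_bigr => n _; rewrite expr2 -mulrA mulKf ?gt_eqF.
case: EY EY2 => iY EY [iY2 EY2].
have -> : 'V_P[Y] = (\sum_n (p n)^-1 * s n - (\sum_n q n) ^+ 2)%:E.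
  rewrite /variance covarianceE; [|exact/Lfun1_integrable..].
  have -> : ('E_P[Y] = (\sum_n q n)%:E)%E by rewrite unlock.
  by rewrite unlock EY2 -EFinM -EFinB -expr2.
rewrite lee_fin.
rewrite [leLHS](eq_bigr (fun n => (p n)^-1 * s n - (p n)^-1 * q n ^+ 2)); last first.
  by move=> n _; rewrite mulrBr.
by rewrite sumrB lerB// sqr_sum_le_weighted.
Qed.

(** * Quadratic functions and their gradients *)

Section Quadratic.
Context (R : realType).

(** The difference quotient is exactly [b + h * c] for nonzero [h]. The abstract [V] covers
    directions in both vector and matrix spaces. *)
Lemma derive_quadratic (V : normedModType R) (g : V -> R) (x v : V) (b c : R) :
  (forall h : R, g (h *: v + x) = g x + h * b + h ^+ 2 * c) -> 'D_v g x = b.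
Proof.
move=> gE; apply: cvg_lim => //.
have : (fun h : R => b + h * c) @ 0^' --> b.
  rewrite -[X in _ --> X]addr0 -[X in _ + X](mul0r c).
  apply: cvgD; first exact: cvg_cst.
  by apply: cvgM; [exact: nbhs_dnbhs | exact: cvg_cst].
apply: cvg_trans; apply: near_eq_cvg; near=> h.
have h0 : h != 0 by near: h; exact: nbhs_dnbhs_neq.
by rewrite /= gE /GRing.scale /=; field.
Unshelve. all: by end_near. Qed.

Context (d : nat) (M : 'M[R]_d) (z : 'cV[R]_d).

Definition quad (x : 'cV[R]_d) : R := 2^-1 * ((x - z)^T *m M *m (x - z)) 0 0.

Hypothesis Msym : M^T = M.

(** By symmetry of [M] the two cross terms are transposes of each other, hence equal as scalars, and
    their sum absorbs the factor 1/2. *)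
Lemma quadD x w : quad (w + x) = quad x + (w^T *m (M *m (x - z))) 0 0 + 2^-1 * (w^T *m M *m w) 0 0.
Proof.
rewrite /quad -addrA; set y := x - z.
have -> : (w + y)^T *m M *m (w + y) =
   y^T *m M *m y + (w^T *m (M *m y) + (w^T *m (M *m y))^T) + w^T *m M *m w.
  rewrite !trmx_mul Msym trmxK [(w + y)^T]linearD/= !mulmxDl !mulmxDr !mulmxA.
  move: (y^T *m M *m y) (w^T *m M *m y) (y^T *m M *m w) (w^T *m M *m w) => a b c e.
  by apply/matrixP => i j; rewrite !mxE; ring.
by rewrite !mxE; field.
Qed.

(** Directional derivatives alone would not suffice; in coordinates the function is a polynomial,
    built by sums and products from differentiable maps. *)
Lemma differentiable_quad x : differentiable quad x.
Proof.
have -> : quad = (fun x => 2^-1 * \sum_j (\sum_i (x i 0 - z i 0) * M i j) * (x j 0 - z j 0)).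
  apply/funext => y; rewrite /quad !mxE; congr (_ * _); apply: eq_bigr => j _.
  by rewrite !mxE; congr (_ * _); apply: eq_bigr => i _; rewrite !mxE.
have D i : differentiable (fun y : 'cV[R]_d => y i 0 - z i 0) x.
  by apply: differentiableB => //; exact: differentiable_coord.
have Dsum (F : 'I_d -> 'cV[R]_d -> R) : (forall i, differentiable (F i) x) ->
    differentiable (fun y => \sum_i F i y) x.
  move=> DF; rewrite (_ : (fun y => _) = \sum_i F i); last first.
    by apply/funext => y; rewrite fct_sumE.
  exact: differentiable_sum.
apply: differentiableM => //; apply: (Dsum _) => j.
apply: differentiableM => //; apply: Dsum => i.
exact: differentiableM.
Qed.

Lemma tr_delta_mulmx (w : 'cV[R]_d) i : ((delta_mx i 0 : 'cV[R]_d)^T *m w) 0 0 = w i 0.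
Proof.
rewrite mxE (bigD1 i)//= !mxE !eqxx mul1r big1 ?addr0// => j /negPf ji.
by rewrite !mxE ji mul0r.
Qed.

(** A chain rule for affine [L], with [w] the increment along [v]. It serves the gradients in the
    point, in [m] and in [C] alike. *)
Lemma derive_quad_lin (V : normedModType R) (L : V -> 'cV[R]_d) (x v : V) (w : 'cV[R]_d) :
  (forall h : R, L (h *: v + x) = h *: w + L x) ->
  'D_v (fun x => quad (L x)) x = (w^T *m (M *m (L x - z))) 0 0.
Proof.
move=> LE; apply: (derive_quadratic (c := 2^-1 * (w^T *m M *m w) 0 0)) => h.
rewrite LE quadD linearZ/= -!scalemxAl -scalemxAr !mxE.
by ring.
Qed.

Lemma grad_quad x : grad quad x = M *m (x - z).
Proof.
apply/matrixP => i j; rewrite (ord1 j) mxE -[RHS]tr_delta_mulmx.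
exact: (derive_quad_lin (L := id)).
Qed.

Lemma gradW_m_quad m C u : gradW_m quad m C u = M *m (C *m u + m - z).
Proof.
apply/matrixP => i j; rewrite (ord1 j) mxE -[RHS]tr_delta_mulmx.
by apply: (derive_quad_lin (L := fun m' => C *m u + m')) => h; rewrite addrCA.
Qed.

Lemma gradW_C_quad m C u :
  gradW_C quad m C u = M *m (C *m u + m - z) *m u^T.
Proof.
apply/matrixP => i j; rewrite mxE.
(* Moving entry [(i, j)] of [C'] by [h] moves [C' *m u] by [h] times [u j 0] along the [i]-th basis
   vector. *)
rewrite (derive_quad_lin (L := fun C' => C' *m u + m) (w := u j 0 *: delta_mx i 0)).
  by rewrite linearZ/= -scalemxAl mxE tr_delta_mulmx [RHS]mxE big_ord1 [u^T _ _]mxE mulrC.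
move=> h; rewrite mulmxDl -scalemxAl -addrA; congr (_ *: _ + _).
apply/matrixP => k l; rewrite !mxE (bigD1 j)//= !mxE (ord1 l) eqxx !andbT big1 ?addr0 1?mulrC//.
by move=> r /negPf rj; rewrite mxE rj andbF mul0r.
Qed.

End Quadratic.

(** * Assembly of the variance bound *)

Lemma sqr_fnorm (R : realType) m n (A : 'M[R]_(m, n)) :
  fnorm A ^+ 2 = \sum_i \sum_j A i j ^+ 2.
Proof.
rewrite sqr_sqrtr//; apply: sumr_ge0 => i _.
by apply: sumr_ge0 => j _; exact: sqr_ge0.
Qed.

Unset Implicit Arguments.

Theorem theorem4 (R : realType) (d N : nat) (M : 'I_N -> 'M[R]_d)
  (zbar : 'I_N -> 'cV[R]_d) :
  (forall n, (M n)^T = M n) ->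
  exists f : 'I_N -> 'cV[R]_d -> R,
    (forall n, (forall x, differentiable (f n) x) /\
               matrix_smooth (M n) (f n) /\ grad (f n) (zbar n) = 0) /\
    (forall (dT : measure_display) (T : measurableType dT) (P : probability T R)
            (X : 'I_d -> T -> R) (kappa : R) (pi : 'I_N -> R) (Nv : T -> 'I_N),
       (forall n, 0 < pi n) -> \sum_(n < N) pi n = 1 ->
       (forall n, P (Nv @^-1` [set n]) = (pi n)%:E) ->
       standardized_indep P X Nv kappa ->
       forall (m : 'cV[R]_d) (C : 'M[R]_d),
         let u t : 'cV[R]_d := \col_(i < d) X i t in
         let gm t := (pi (Nv t))^-1 *: gradW_m (f (Nv t)) m C (u t) in
         let gC t := (pi (Nv t))^-1 *: gradW_C (f (Nv t)) m C (u t) in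
         ((\sum_(n < N) (pi n)^-1 *
            (d%:R * fnorm (M n *m (m - zbar n)) ^+ 2
             + (d%:R + kappa - 1) * fnorm (M n *m C) ^+ 2))%:E
          <= trV P gm gC)%E).
Proof.
move=> Msym; exists (fun n => quad (M n) (zbar n)); split.
  move=> n; split; first exact: differentiable_quad.
  split.
    by move=> y z; rewrite !grad_quad// -mulmxBr opprB addrA subrK lexx.
  by rewrite grad_quad// subrr mulmx0.
move=> dT T P X kappa pi Nv pi0 pi1 PNv [mX mNv indep _ mom] m C.
cbv beta zeta; set gm := (X in trV P X _); set gC := (X in trV P _ X).
pose u t : 'cV[R]_d := \col_(i < d) X i t.
have EX i : ('E_P[X i] = 0)%E by case: (mom i).
have EX3 i : ('E_P[fun t => (X i t ^+ 3)%R] = 0)%E by case: (mom i).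
have VX i : ('V_P[X i] = 1)%E by case: (mom i).
have iX4 i : P.-integrable setT (fun t => (X i t ^+ 4)%:E) by case: (mom i).
have EX4 i : ('E_P[fun t => (X i t ^+ 4)%R] = kappa%:E)%E by case: (mom i).
pose a n := M n *m (m - zbar n); pose B n := M n *m C.
pose y n i t := a n i 0 + \sum_j B n i j * X j t.
(* Both blocks of the gradient are built from this vector: it is the [m] block, and its product with
   the transpose of [u t] is the [C] block. *)
have gradE n t : M n *m (C *m u t + m - zbar n) = \col_i y n i t.
  rewrite -addrA mulmxDr mulmxA [LHS]addrC -/(a n) -/(B n); apply/matrixP => i k.
  rewrite (ord1 k) [RHS]mxE [LHS]mxE; congr (_ + _); rewrite mxE.
  by apply: eq_bigr => j _; rewrite [u t _ _]mxE.
have pE n : fine (P (Nv @^-1` [set n])) = pi n by rewrite PNv.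
have gmE i : (fun t => gm t i ord0) = (fun t => (pi (Nv t))^-1 * y (Nv t) i t).
  by apply/funext => t; rewrite /gm gradW_m_quad// gradE !mxE.
have gCE i l : (fun t => gC t i l) = (fun t => (pi (Nv t))^-1 * (y (Nv t) i t * X l t)).
  by apply/funext => t; rewrite /gC gradW_C_quad// gradE !mxE big_ord1 !mxE.
have Vm i : ((\sum_n (pi n)^-1 * (a n i 0 ^+ 2 + \sum_j B n i j ^+ 2 - a n i 0 ^+ 2))%:E
    <= 'V_P[fun t => gm t i ord0])%E.
  rewrite gmE; apply: (variance_mixture_ge pi0 pi1 (y := fun n => y n i)) => n; rewrite -pE.
    exact: (has_mean_affine mX mNv indep iX4 EX EX3 VX EX4).
  exact: (has_mean_affine_sqr mX mNv indep iX4 EX EX3 VX EX4).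
have VC i l : ((\sum_n (pi n)^-1 * (a n i 0 ^+ 2 + \sum_j B n i j ^+ 2
      + (kappa - 1) * B n i l ^+ 2 - B n i l ^+ 2))%:E
    <= 'V_P[fun t => gC t i l])%E.
  rewrite gCE; apply: (variance_mixture_ge pi0 pi1
    (y := fun n t => y n i t * X l t)) => n; rewrite -pE.
    exact: (has_mean_affine_coord mX mNv indep iX4 EX EX3 VX EX4).
  exact: (has_mean_affine_coord_sqr mX mNv indep iX4 EX EX3 VX EX4).
rewrite /trV; apply: (@le_trans _ _
  ((\sum_i \sum_n (pi n)^-1 * (a n i 0 ^+ 2 + \sum_j B n i j ^+ 2 - a n i 0 ^+ 2))%:E
   + (\sum_i \sum_l \sum_n (pi n)^-1 * (a n i 0 ^+ 2 + \sum_j B n i j ^+ 2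
      + (kappa - 1) * B n i l ^+ 2 - B n i l ^+ 2))%:E)%E); last first.
  rewrite -!sumEFin; apply: leeD; first by apply: lee_sum.
  by apply: lee_sum => i _; rewrite -sumEFin; apply: lee_sum.
(* The entrywise bounds sum exactly to the claimed constant: once the sum over [n] is moved outside,
   the two sides agree for each [n]. *)
rewrite -EFinD lee_fin le_eqVlt; apply/orP; left; apply/eqP.
rewrite [X in _ = X + _]exchange_big/=.
rewrite [X in _ = _ + X](eq_bigr _ (fun i _ => exchange_big _ _ _ _ _ _))/=.
rewrite [X in _ = _ + X]exchange_big/= -big_split/=.
apply: eq_bigr => n _; rewrite !sqr_fnorm.
under [X in _ = _ + X]eq_bigr do rewrite -mulr_sumr.
rewrite -!mulr_sumr -mulrDr; congr (_ * _).
rewrite -/(a n) -/(B n).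
under [\sum_i \sum_(j < 1) _]eq_bigr do rewrite big_ord1.
under [X in _ = X + _]eq_bigr do rewrite addrAC subrr add0r.
(* Summing over [l] yields [d] copies of the common part, while [kappa - 1] and the subtracted
   square add [kappa - 2]. The [m] block supplies one more copy of the sum of squares of [B n],
   giving [d + kappa - 1]. *)
have -> : \sum_i \sum_l (a n i 0 ^+ 2 + \sum_j B n i j ^+ 2
      + (kappa - 1) * B n i l ^+ 2 - B n i l ^+ 2) =
   \sum_i (d%:R * a n i 0 ^+ 2 + (d%:R + kappa - 2) * \sum_j B n i j ^+ 2).
  have sum_cst (c : R) : \sum_(l < d) c = d%:R * c.
    by rewrite sumr_const card_ord mulr_natl.
  apply: eq_bigr => i _; rewrite !big_split/= sumrN !sum_cst -mulr_sumr.
  by ring.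
by rewrite big_split/= -!mulr_sumr; ring.
Qed.
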